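(* Let $G=(V,E)$ be a graph, set $n:=|V|$, and let $0=\mu_1\le\mu_2\le\dots\le\mu_n$ denote the eigenvalues of the Laplacian matrix of $G$. Then we have $$h_1(B_0(G))=\tfrac12\varphi(\overline G)\ \le\ \tfrac12\varphi_H(G)=\frac n4\Big(1-\frac{\mu_2}{\mu_n}\Big),$$ with equality if $G$ is vertex- and edge-transitive.
   Context: The graph $G$ is arbitrary (not necessarily bipartite), and $\overline G=(V,\overline E)$ is its complement. The Laplacian matrix of $G$ is $L_G=D_G-A_G$, where $A_G$ is the adjacency matrix and $D_G$ the diagonal matrix of vertex degrees, and $\varphi_H(G):=\frac n2\big(1-\frac{\mu_2}{\mu_n}\big)$. The extended bipartite double $B_0(G)$ is the bipartite graph with bipartition $V\cup V'$, where $V'=\{i':i\in V\}$ is a disjoint copy of $V$, whose edges are the pairs $\{i,j'\}$ and $\{j,i'\}$ for $\{i,j\}\in E$ and the pairs $\{i,i'\}$ for $i\in V$. For a bipartite graph $H=(W=W_1\cup W_2,F)$, let $C$ be the symmetric matrix indexed by $W$ with entries $\frac12$ at positions $(i,j)$ with $i,j$ on different sides of the bipartition and $0$ elsewhere; then $$h_1(H)=\max\{\langle C,X\rangle: X\text{ real symmetric indexed by }W,\ X\succeq0,\ \mathrm{Tr}(X)=1,\ X_{ij}=0\text{ for }\{i,j\}\in F\},$$ with $\langle X,Y\rangle=\mathrm{Tr}(XY)$. For a graph $K=(V,E_K)$, $\varphi(K)=\min\{\lambda_{abs}(M): M\text{ real symmetric indexed by }V,\ M_{ij}=1\text{ for all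 }\{i,j\}\in E_K\}$, where $\lambda_{abs}(M)$ is the maximum absolute value of an eigenvalue of $M$. *)

(* Defs.v *)
From mathcomp Require Import all_boot all_order all_algebra all_fingroup.
From mathcomp Require Import all_classical all_reals.

Set Implicit Arguments.
Unset Strict Implicit.
Unset Printing Implicit Defensive.

Import Order.TTheory GRing.Theory Num.Theory.

Local Open Scope ring_scope.
Local Open Scope classical_set_scope.

Record graph (V : finType) := Graph {
  adj :> rel V;
  adj_sym : symmetric adj;
  adj_irr : irreflexive adj }.

Record bigraph (W : finType) := Bigraph {
  bigraph_graph :> graph W;
  side : W -> bool;
  side_adj : forall x y, bigraph_graph x y -> side x != side y }.

Section Graphs.
Variables (V : finType) (G : graph V).

Definition compl_adj : rel V := fun x y => (x != y) && ~~ G x y.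

Lemma compl_sym : symmetric compl_adj.
Proof. by move=> x y; rewrite /compl_adj eq_sym adj_sym. Qed.

Lemma compl_irr : irreflexive compl_adj.
Proof. by move=> x; rewrite /compl_adj eqxx. Qed.

Definition compl : graph V := Graph compl_sym compl_irr.

(* [inl i] stands for the vertex i of V and [inr i] for its copy i'. *)
Definition B0_adj : rel (V + V) := fun x y =>
  match x, y with
  | inl i, inr j | inr i, inl j => (i == j) || G i j
  | _, _ => false
  end.

Lemma B0_sym : symmetric B0_adj.
Proof. by case=> x [] y //=; rewrite eq_sym adj_sym. Qed.

Lemma B0_irr : irreflexive B0_adj.
Proof. by case. Qed.

Definition B0_graph : graph (V + V)%type := Graph B0_sym B0_irr.

Definition B0_side (x : V + V) : bool := if x is inl _ then true else false.

Lemma B0_side_adj x y : B0_graph x y -> B0_side x != B0_side y.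
Proof. by case: x => x; case: y. Qed.

Definition B0 : bigraph (V + V)%type := Bigraph B0_side_adj.

Definition automorphism (s : {perm V}) : Prop :=
  forall x y, G (s x) (s y) = G x y.

Definition vertex_transitive : Prop :=
  forall x y, exists2 s : {perm V}, automorphism s & s x = y.

(* Edges are unordered pairs, so an automorphism may reverse the edge. *)
Definition edge_transitive : Prop :=
  forall x y z t, G x y -> G z t ->
  exists2 s : {perm V}, automorphism s & [set s x; s y]%SET = [set z; t]%SET.

End Graphs.

(* A matrix indexed by a finite type V is an element of 'M_#|V|, the entry at
   (x, y) being that at (enum_rank x, enum_rank y). *)
Section Matrices.
Variable R : realType.

Definition psdmx n (X : 'M[R]_n) : Prop :=
  X \is symmetricmx /\ forall u : 'cV[R]_n, 0 <= (u^T *m X *m u) 0 0.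

(* The eigenvalues in nondecreasing order, repeated according to their
   multiplicity; [::] if the characteristic polynomial does not split over R,
   which does not happen for symmetric A. *)
Definition eigenvalues n (A : 'M[R]_n) : seq R :=
  xget [::] [set s | sorted <=%R s /\
                     char_poly A = (\prod_(a <- s) ('X - a%:P))%R].

Definition lambda_abs n (A : 'M[R]_n) : R :=
  sup [set `|a| | a in [set a | eigenvalue A a]].

Definition adjmx (V : finType) (G : graph V) : 'M[R]_#|V| :=
  \matrix_(i, j) (G (enum_val i) (enum_val j))%:R.

Definition degmx (V : finType) (G : graph V) : 'M[R]_#|V| :=
  diag_mx (\row_i #|[set y | G (enum_val i) y]%SET|%:R).

Definition laplacian (V : finType) (G : graph V) : 'M[R]_#|V| :=
  degmx G - adjmx G.

Definition phiH (V : finType) (G : graph V) : R :=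
  let mu := eigenvalues (laplacian G) in
  #|V|%:R / 2 * (1 - mu`_1 / mu`_#|V|.-1).

Definition phi_values (V : finType) (K : graph V) : set R :=
  [set lambda_abs M | M in [set M : 'M[R]_#|V| |
     M \is symmetricmx /\
     forall i j, K i j -> M (enum_rank i) (enum_rank j) = 1]].

Definition phi (V : finType) (K : graph V) : R := inf (phi_values K).

Definition bipmx (W : finType) (H : bigraph W) : 'M[R]_#|W| :=
  \matrix_(i, j)
    (if side H (enum_val i) != side H (enum_val j) then 2^-1 else 0).

Definition h1_values (W : finType) (H : bigraph W) : set R :=
  [set \tr (bipmx H *m X) | X in [set X : 'M[R]_#|W| |
     [/\ psdmx X, \tr X = 1 &
         forall i j, H i j -> X (enum_rank i) (enum_rank j) = 0]]].

Definition h1 (W : finType) (H : bigraph W) : R := sup (h1_values H).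

End Matrices.

Arguments adjmx R {V} G.
Arguments degmx R {V} G.
Arguments laplacian R {V} G.
Arguments phiH R {V} G.
Arguments phi_values R {V} K.
Arguments phi R {V} K.
Arguments bipmx R {W} H.
Arguments h1_values R {W} H.
Arguments h1 R {W} H.

(* Main.v *)
Require Import Defs.
From mathcomp Require Import all_boot all_order all_algebra all_fingroup.
From mathcomp Require Import all_classical all_reals.
From mathcomp Require Import ring lra.
From mathcomp Require Import complex.

Set Implicit Arguments.
Unset Strict Implicit.
Unset Printing Implicit Defensive.

Import Order.TTheory GRing.Theory Num.Theory.

Local Open Scope ring_scope.
Local Open Scope classical_set_scope.

(** Both programs are dual to each other, so that the first equality is strong
duality. A feasible matrix X of [h1 (B0 G)] splits into blocks along V and V',
and <C, X> is the sum of the entries of the off-diagonal block B, which is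
supported on the edges of the complement of G. If M is feasible for
[phi (compl G)], then <J, B> = <M, B>, and since
2 u^T M v <= lambda_abs(M) (|u|^2 + |v|^2) by polarisation, this is at most
lambda_abs(M) / 2 ([h1_weak_duality]).

Conversely, let h be the value of the first program. The linear form <J, B>, on
the matrices B supported on the complement, is bounded by h tr X for every
positive semidefinite X with off-diagonal block B. A finite-dimensional
Hahn-Banach argument ([dominated_extend]) extends it to a form <M, B> on all
matrices with the same bound; this M is feasible, and testing the bound on X of
rank one gives lambda_abs(M) <= 2 h ([h1_strong_duality]). So the minimum in phi
is attained and equals 2 h. The same extension theorem, applied to the
bound u^T Y u <= c |u|^2 on matrices Y, produces an optimal X, so that the maximum
in h1 is attained too ([h1_attained]); no compactness is involved.

For the inequality, the matrices J - a I + b L ([pencil]) are feasible for the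
complement. Their eigenvalues are n - a on the constants and b mu_i - a on the
orthogonal complement of the constants, and the choice b = n / mu_n,
a = n/2 (1 + mu_2 / mu_n) makes the largest absolute value equal to
n/2 (1 - mu_2 / mu_n) ([phi_compl_le_phiH]); with the convention x / 0 = 0 the
edgeless graph needs no separate treatment. If G is vertex- and edge-transitive,
then averaging an optimal M over the automorphism group does not increase
lambda_abs, and yields a matrix which is constant on the diagonal and on the
edges, that is a member of the pencil ([average_pencil]); no member of the pencil
beats the bound ([pencil_bound]).

The eigenvalue facts all come from an orthogonal diagonalisation of real
symmetric matrices ([eigenvalues_spectral]). *)

(** * Quadratic forms *)

Definition bilin (R : realType) n (A : 'M[R]_n) (u v : 'cV[R]_n) : R :=
  (u^T *m A *m v) 0 0.

Definition sqnorm (R : realType) n (u : 'cV[R]_n) : R := (u^T *m u) 0 0.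

Lemma bilinE (R : realType) n (A : 'M[R]_n) (u v : 'cV[R]_n) :
  bilin A u v = \sum_i \sum_j u i 0 * A i j * v j 0.
Proof.
rewrite /bilin mxE exchange_big /=; apply: eq_bigr => j _.
by rewrite mxE mulr_suml; apply: eq_bigr => i _; rewrite mxE.
Qed.

Lemma sqnormE (R : realType) n (u : 'cV[R]_n) : sqnorm u = \sum_i u i 0 ^+ 2.
Proof. by rewrite /sqnorm mxE; apply: eq_bigr => i _; rewrite mxE expr2. Qed.

Lemma sqnorm_ge0 (R : realType) n (u : 'cV[R]_n) : 0 <= sqnorm u.
Proof. by rewrite sqnormE sumr_ge0 // => i _; rewrite sqr_ge0. Qed.

Lemma sqnorm_gt0 (R : realType) n (u : 'cV[R]_n) : u != 0 -> 0 < sqnorm u.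
Proof.
move=> u0; rewrite lt_def sqnorm_ge0 andbT; apply: contra u0.
rewrite sqnormE psumr_eq0 => [/allP u0|i _]; last exact: sqr_ge0.
apply/eqP/colP => i; have := u0 i (mem_index_enum _).
by rewrite sqrf_eq0 mxE => /eqP.
Qed.

Lemma bilin_col (R : realType) n (A : 'M[R]_n) u v :
  bilin A u v = \sum_i u i 0 * (A *m v) i 0.
Proof. by rewrite /bilin -mulmxA mxE; apply: eq_bigr => i _; rewrite mxE. Qed.

Lemma bilin_addmx (R : realType) n (A B : 'M[R]_n) u v :
  bilin (A + B) u v = bilin A u v + bilin B u v.
Proof. by rewrite /bilin mulmxDr mulmxDl mxE. Qed.

Lemma bilin_scalemx (R : realType) n a (A : 'M[R]_n) u v :
  bilin (a *: A) u v = a * bilin A u v.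
Proof. by rewrite /bilin -scalemxAr -scalemxAl mxE. Qed.

Lemma bilin_tr (R : realType) n (A : 'M[R]_n) u v : bilin A^T u v = bilin A v u.
Proof.
by rewrite /bilin -[in RHS](trmxK (v^T *m A *m u)) [RHS]mxE !trmx_mul trmxK mulmxA.
Qed.

Lemma bilinD (R : realType) n (A : 'M[R]_n) u v : bilin A (u + v) (u + v) =
  bilin A u u + bilin A u v + bilin A v u + bilin A v v.
Proof.
have addE (B C : 'M[R]_1) : (B + C) 0 0 = B 0 0 + C 0 0 by rewrite mxE.
by rewrite /bilin [(u + v)^T]linearD /= !mulmxDl !mulmxDr !addE; ring.
Qed.

Lemma bilinN (R : realType) n (A : 'M[R]_n) u v :
  (bilin A u (- v) = - bilin A u v) * (bilin A (- u) v = - bilin A u v).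
Proof.
have oppE (B : 'M[R]_1) : (- B) 0 0 = - B 0 0 by rewrite mxE.
by rewrite /bilin [(- u)^T]linearN /= mulmxN !mulNmx !oppE.
Qed.

Lemma sqnorm_bilin (R : realType) n (u : 'cV[R]_n) : sqnorm u = bilin 1%:M u u.
Proof. by rewrite /bilin mulmx1. Qed.

Lemma bilinZr (R : realType) n (A : 'M[R]_n) a u v :
  bilin A u (a *: v) = a * bilin A u v.
Proof. by rewrite /bilin -scalemxAr mxE. Qed.

Lemma bilinZl (R : realType) n (A : 'M[R]_n) a u v :
  bilin A (a *: u) v = a * bilin A u v.
Proof. by rewrite -bilin_tr bilinZr bilin_tr. Qed.

(** * The spectral theorem over the reals *)

Lemma symmetricmxP (R : realType) n (A : 'M[R]_n) :
  reflect (A^T = A) (A \is symmetricmx).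
Proof.
apply: (iffP (is_hermitianmxP _ _ A)); rewrite expr0 scale1r map_mx_id //.
Qed.

(** The matrix is Hermitian over the complex numbers, hence has a real complex
eigenvalue, which is a root of the real characteristic polynomial. *)
Lemma symmetric_eigenvalue (R : realType) n (A : 'M[R]_n.+1) :
  A^T = A -> exists a, eigenvalue A a.
Proof.
move=> symA; pose toC := @complex.real_complex_def R (Phant R).
pose AC := map_mx toC A.
have AC_herm : AC \is hermsymmx.
  apply: realsym_hermsym.
    apply/is_hermitianmxP; rewrite expr0 scale1r map_mx_id //.
    by rewrite /AC map_trmx symA.
  apply/mxOverP => i j; rewrite !mxE.
  by apply/complex.complex_realP; exists (A i j).
set P := spectralmx AC; set d := spectral_diag AC.
have eA : AC = invmx P *m diag_mx d *m P.
  by apply/orthomx_spectralP/hermitian_normalmx.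
have /mxOverP/(_ 0 0)/complex.complex_realP[a ea] :=
  hermitian_spectral_diag_real AC_herm.
exists a; rewrite eigenvalue_root_char -(fmorph_root toC).
have -> : map_poly toC (char_poly A) = char_poly AC by rewrite map_char_poly.
rewrite -eigenvalue_root_char; apply/eigenvalueP; exists (row 0 P).
  rewrite {1}eA !mulmxA -row_mul mulmxV ?spectral_unit // row1.
  rewrite -rowE row_diag_mx -scalemxAl -rowE.
  by rewrite /d ea.
have := spectral_unit AC; rewrite -/P => uP; apply/eqP => r0.
have /(congr1 (row 0)) := mulmxV uP; rewrite row_mul r0 mul0mx row1.
by move=> /rowP/(_ 0)/eqP; rewrite !mxE eq_sym oner_eq0.
Qed.

(** The reflection exchanging the first basis vector e and u, along v = u - e.
Its columns complete u to an orthonormal basis. *)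
Lemma householder (R : realType) n (u : 'cV[R]_n.+1) : u^T *m u = 1%:M ->
  exists Q : 'M[R]_n.+1,
    [/\ Q^T = Q, Q *m Q = 1%:M & Q *m delta_mx 0 0 = u].
Proof.
move=> u1; pose e : 'cV[R]_n.+1 := delta_mx 0 0.
have e1 : e^T *m e = 1%:M.
  by rewrite trmx_delta mul_delta_mx; apply/matrixP => i j; rewrite !ord1 !mxE.
have [ue|ue] := eqVneq u e.
  by exists 1%:M; rewrite trmx1 !mul1mx ue.
have eu : e^T *m u = (u 0 0)%:M.
  by rewrite trmx_delta -rowE [LHS]mx11_scalar !mxE.
have ue' : u^T *m e = (u 0 0)%:M.
  by rewrite -[LHS]trmxK trmx_mul trmxK eu tr_scalar_mx.
pose v := u - e; pose s := 2 - 2 * u 0 0.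
have vv : v^T *m v = s%:M.
  rewrite /v [(_ - _)^T]linearB /= mulmxBl !mulmxBr u1 e1 eu ue'.
  by rewrite -!raddfB /=; congr (_%:M); rewrite /s; ring.
have ve : v^T *m e = (- (s / 2))%:M.
  rewrite /v [(_ - _)^T]linearB /= mulmxBl e1 ue' -raddfB /=.
  by congr (_%:M); rewrite /s; field.
have s0 : s != 0.
  have : v != 0 by rewrite subr_eq0.
  by move=> /sqnorm_gt0; rewrite /sqnorm vv mxE eqxx mulr1n => /gt_eqF ->.
(* s = |u - e|^2, as both vectors have norm 1. *)
exists (1%:M - (2 / s) *: (v *m v^T)); split.
- by rewrite linearB /= linearZ /= trmx_mul trmxK trmx1.
- rewrite mulmxBl mul1mx mulmxBr mulmx1 -scalemxAl -scalemxAr scalerA.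
  rewrite mulmxA -[_ *m v^T *m v]mulmxA vv mul_mx_scalar -scalemxAl scalerA.
  rewrite -scalerBl -addrA -opprD -scalerDl.
  suff -> : 2 / s + (2 / s - 2 / s * (2 / s) * s) = 0 by rewrite scale0r subr0.
  by field.
- rewrite mulmxBl mul1mx -scalemxAl -mulmxA ve mul_mx_scalar scalerA.
  have -> : 2 / s * - (s / 2) = -1 by field.
  by rewrite scaleN1r opprK /v addrC subrK.
Qed.

(** By induction on the size: conjugating by a Householder reflection sends a unit
eigenvector to the first basis vector, after which symmetry clears the first row
and column and leaves a smaller symmetric block. *)
Theorem real_spectral (R : realType) n (A : 'M[R]_n) : A^T = A ->
  exists P (d : 'rV[R]_n), P *m P^T = 1%:M /\ A = P^T *m diag_mx d *m P.
Proof.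
elim: n A => [|n IHn] A symA.
  by exists 1%:M, 0; split; apply/matrixP => -[].
have [a /eigenvalueP[w wA w0]] := symmetric_eigenvalue symA.
pose c := (Num.sqrt ((w *m w^T) 0 0))^-1; pose u := c *: w^T.
have wT0 : w^T != 0 by rewrite trmx_eq0.
have ww0 : 0 < (w *m w^T) 0 0.
  by have := sqnorm_gt0 wT0; rewrite /sqnorm trmxK.
have u1 : u^T *m u = 1%:M.
  have -> : u^T = c *: w by rewrite /u [(_ *: _)^T]linearZ /= trmxK.
  rewrite /u -scalemxAl -scalemxAr scalerA.
  rewrite [w *m _]mx11_scalar scale_scalar_mx /c -invfM -expr2 sqr_sqrtr ?ltW //.
  by rewrite mulVf // gt_eqF.
have Au : A *m u = a *: u.
  rewrite /u -scalemxAr -[A]symA -trmx_mul wA linearZ /= scalerA.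
  by rewrite [c * a]mulrC -scalerA.
have [Q [QT QQ Qe]] := householder u1.
pose e : 'cV[R]_n.+1 := delta_mx 0 0.
have [B defB] : exists B : 'M_(1 + n), B = Q *m A *m Q by exists (Q *m A *m Q).
have BT : B^T = B by rewrite defB !trmx_mul QT symA mulmxA.
have Be : B *m e = a *: e.
  by rewrite defB -!mulmxA Qe Au -scalemxAr -Qe mulmxA QQ mul1mx.
have Bcol i : B i 0 = a *+ (i == 0).
  by move/colP: Be => /(_ i); rewrite -colE !mxE andbT mulr_natr.
have Brow i : B 0 i = a *+ (i == 0) by rewrite -BT mxE Bcol.
pose B' := drsubmx B.
have B'T : B'^T = B' by rewrite /B' trmx_drsub BT.
have eB : B = block_mx a%:M 0 0 B'.
  rewrite -[LHS]submxK; congr block_mx; apply/matrixP => i j;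
    rewrite !mxE ?ord1 ?lshift0.
  - by rewrite Bcol eqxx mulr1n.
  - by rewrite Brow.
  - by rewrite Bcol.
have [P' [d' [PP' eB']]] := IHn B' B'T.
pose P : 'M_(1 + n) := block_mx 1%:M 0 0 P'.
pose d : 'rV_(1 + n) := row_mx a%:M d'.
have PP : P *m P^T = 1%:M.
  rewrite /P tr_block_mx mulmx_block !(mulmx0, mul0mx, addr0, add0r, trmx0).
  by rewrite trmx1 mul1mx PP' -scalar_mx_block.
have BP : B = P^T *m diag_mx d *m P.
  rewrite eB /P /d diag_mx_row tr_block_mx !mulmx_block.
  rewrite !(mulmx0, mul0mx, addr0, add0r, trmx0, trmx1, mul1mx, mulmx1).
  by rewrite -eB'; congr block_mx; apply/matrixP => i j; rewrite !ord1 !mxE.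
exists (P *m Q), d; split.
  by rewrite trmx_mul QT mulmxA -[P *m Q *m Q]mulmxA QQ mulmx1 PP.
have -> : A = Q *m B *m Q.
  by rewrite defB -!mulmxA QQ mulmx1 mulmxA QQ mul1mx.
by rewrite BP trmx_mul QT !mulmxA.
Qed.

Lemma bilin_diag (R : realType) n (P : 'M[R]_n) d (u v : 'cV[R]_n) :
  bilin (P^T *m diag_mx d *m P) u v =
  \sum_i d 0 i * ((P *m u) i 0 * (P *m v) i 0).
Proof.
rewrite /bilin !mulmxA -trmx_mul -!mulmxA mxE; apply: eq_bigr => i _.
rewrite mxE mul_diag_mx mxE.
by rewrite mulrCA.
Qed.

Lemma sqnorm_orthogonal (R : realType) n (P : 'M[R]_n) (u : 'cV[R]_n) :
  P *m P^T = 1%:M -> sqnorm (P *m u) = sqnorm u.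
Proof.
move=> /mulmx1C PP.
by rewrite /sqnorm trmx_mul mulmxA -[u^T *m _ *m _]mulmxA PP mulmx1.
Qed.

Lemma char_poly_diagonalized (R : realType) n (P : 'M[R]_n) d :
  P *m P^T = 1%:M ->
  char_poly (P^T *m diag_mx d *m P) = \prod_i ('X - (d 0 i)%:P).
Proof.
move=> PP; have PC := mulmx1C PP.
pose f (M : 'M[R]_n) := map_mx (@polyC R) M.
have -> : char_poly (P^T *m diag_mx d *m P) = char_poly (diag_mx d).
  rewrite /char_poly /char_poly_mx.
  have -> : 'X%:M - f (P^T *m diag_mx d *m P) =
            f P^T *m ('X%:M - f (diag_mx d)) *m f P.
    have fPP : f P^T *m f P = 1%:M by rewrite -map_mxM PC map_mx1.
    by rewrite mulmxBr mulmxBl scalar_mxC -['X%:M *m _ *m _]mulmxA fPP mulmx1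
      /f !map_mxM.
  rewrite !det_mulmx mulrAC -det_mulmx -map_mxM PC.
  by rewrite map_mx1 det1 mul1r.
rewrite char_poly_trig; last exact: diag_mx_is_trig.
by apply: eq_bigr => i _; rewrite mxE eqxx mulr1n.
Qed.

(** An orthogonal diagonalisation in which the diagonal is [eigenvalues A] itself:
unique factorisation of the characteristic polynomial identifies that list, up to
a permutation of the basis, with any diagonal produced by the spectral theorem. *)
Theorem eigenvalues_spectral (R : realType) n (A : 'M[R]_n) : A^T = A ->
  [/\ size (eigenvalues A) = n, sorted <=%R (eigenvalues A) &
   exists P : 'M[R]_n, P *m P^T = 1%:M /\
     A = P^T *m diag_mx (\row_i (eigenvalues A)`_i) *m P].
Proof.
move=> symA; have [P [d [PP eA]]] := real_spectral symA.
have cA : char_poly A = \prod_i ('X - (d 0 i)%:P).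
  by rewrite eA char_poly_diagonalized.
pose s := [seq d 0 i | i <- enum 'I_n].
have cs : char_poly A = \prod_(a <- s) ('X - a%:P).
  by rewrite cA /s big_map big_enum.
have [so cE] : sorted <=%R (eigenvalues A) /\
    char_poly A = \prod_(a <- eigenvalues A) ('X - a%:P).
  apply: (@xgetPex _ [::] [set r | sorted <=%R r /\
                     char_poly A = (\prod_(a <- r) ('X - a%:P))%R]).
  exists (sort <=%R s); split; first exact: sort_le_sorted.
  by rewrite cs; apply/perm_big; rewrite perm_sym perm_sort.
have pe : perm_eq (eigenvalues A) s.
  by apply: prod_XsubC_eq; rewrite -cE -cs.
have se : size (eigenvalues A) = n.
  by rewrite (perm_size pe) size_map size_enum_ord.
split=> //.
have /tuple_permP[p ep] : perm_eq (eigenvalues A) [tuple d 0 i | i < n] by [].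
have dp (i : 'I_n) : (eigenvalues A)`_i = d 0 (p i).
  rewrite {1}ep /= (nth_map i) ?size_enum_ord // nth_ord_enum.
  by rewrite tnth_map tnth_ord_tuple.
exists (row_perm p P); split.
  apply/matrixP => i j; move/matrixP: PP => /(_ (p i) (p j)).
  rewrite !mxE (inj_eq perm_inj) => <-.
  by apply: eq_bigr => k _; rewrite !mxE.
rewrite {1}eA; apply/matrixP => i j.
rewrite -!mulmxA !mxE (reindex_perm p) /=.
apply: eq_bigr => k _; rewrite !mul_diag_mx !mxE dp //.
Qed.
(** * Eigenvalue bounds *)

(** Together with [lambda_abs_le], this characterises [lambda_abs M] as the least
c such that |u^T M u| <= c |u|^2, the only form in which it is used below. *)
Lemma lambda_abs_bound (R : realType) n (M : 'M[R]_n) (u : 'cV[R]_n) :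
  M^T = M -> `|bilin M u u| <= lambda_abs M * sqnorm u.
Proof.
move=> symM; have [P [d [PP eM]]] := real_spectral symM.
have root_d a : eigenvalue M a = (a \in [seq d 0 i | i : 'I_n]).
  rewrite eigenvalue_root_char eM char_poly_diagonalized //.
  by rewrite -root_prod_XsubC big_map big_enum.
have d_le i : `|d 0 i| <= lambda_abs M.
  apply: ub_le_sup; last by exists (d 0 i) => //=; rewrite root_d map_f ?mem_enum.
  exists (\sum_j `|d 0 j|) => _ [a Ma <-].
  have /mapP[j _ ->] : a \in [seq d 0 i | i : 'I_n] by rewrite -root_d.
  by rewrite (bigD1 j) //= lerDl sumr_ge0.
rewrite {1}eM bilin_diag -(sqnorm_orthogonal u PP) sqnormE.
rewrite (le_trans (ler_norm_sum _ _ _)) // mulr_sumr ler_sum // => i _.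
by rewrite -expr2 normrM (ger0_norm (sqr_ge0 _)) ler_wpM2r ?sqr_ge0.
Qed.

Lemma lambda_abs_le (R : realType) n (M : 'M[R]_n) c : (0 < n)%N -> M^T = M ->
  (forall u, `|bilin M u u| <= c * sqnorm u) -> lambda_abs M <= c.
Proof.
case: n M => // n M _ symM bM; apply: ge_sup.
  by have [a Ma] := symmetric_eigenvalue symM; exists `|a|, a.
move=> _ [a /= /eigenvalueP[v vM v0] <-].
have uv0 : 0 < sqnorm v^T by apply: sqnorm_gt0; rewrite trmx_eq0.
have := bM v^T; have -> : bilin M v^T v^T = a * sqnorm v^T.
  by rewrite /bilin trmxK vM -scalemxAl mxE /sqnorm trmxK.
by rewrite normrM (gtr0_norm uv0) ler_pM2r.
Qed.

(** In an orthonormal eigenbasis (p_i) of X, with eigenvalues d_i >= 0, the trace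
of Y X is the sum of the d_i p_i^T Y p_i, each at most c d_i. *)
Lemma mxtrace_mul_psd_le (R : realType) n (X Y : 'M[R]_n) c : psdmx X ->
  (forall u, bilin Y u u <= c * sqnorm u) -> \tr (Y *m X) <= c * \tr X.
Proof.
move=> [/symmetricmxP symX psdX] bY; have [P [d [PP eX]]] := real_spectral symX.
pose p i : 'cV[R]_n := P^T *m delta_mx i 0.
have Pp i : P *m p i = delta_mx i 0 by rewrite /p mulmxA PP mul1mx.
have sq_p i : sqnorm (p i) = 1.
  by rewrite -(sqnorm_orthogonal _ PP) Pp /sqnorm trmx_delta mul_delta_mx mxE !eqxx.
have d_ge0 i : 0 <= d 0 i.
  have := psdX (p i); rewrite -/(bilin X _ _) eX bilin_diag (bigD1 i) //=.
  rewrite big1 ?addr0 => [|j ji]; rewrite Pp !mxE ?eqxx ?mulr1 //.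
  by rewrite (negPf ji) mulr0 mulr0.
have trD (D : 'M[R]_n) : \tr (D *m diag_mx d) = \sum_i D i i * d 0 i.
  by apply: eq_bigr => i _; rewrite mul_mx_diag mxE.
have -> : \tr X = \sum_i d 0 i.
  rewrite eX -mulmxA mxtrace_mulC -mulmxA PP mulmx1 -[diag_mx d]mul1mx trD.
  by apply: eq_bigr => i _; rewrite mxE eqxx mul1r.
rewrite eX !mulmxA mxtrace_mulC !mulmxA trD mulr_sumr ler_sum // => i _.
apply: ler_wpM2r => //; have := bY (p i); rewrite sq_p mulr1; congr (_ <= _).
rewrite /bilin /p trmx_mul trmxK trmx_delta -!mulmxA -rowE !mulmxA -colE mxE.
by rewrite -!mulmxA mxE.
Qed.

(** * Extension of dominated linear forms *)

(** [D x c] stands for p(x) <= c, where p is a sublinear functional on the space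
of functions on I. Only upper bounds of p are manipulated, so p itself need not
be named: in each use it is an infimum that never has to be attained. *)
Section HahnBanach.
Variables (R : realType) (I : finType) (D : (I -> R) -> R -> Prop).
Hypothesis D_add : forall x y c d,
  D x c -> D y d -> D (fun i => x i + y i) (c + d).
Hypothesis D_scale : forall t x c,
  0 < t -> D x c -> D (fun i => t * x i) (t * c).
Hypothesis D_exists : forall x, exists c, D x c.

Definition supported (S : {set I}) (x : I -> R) := forall i, i \notin S -> x i = 0.

Definition dominated_on (S : {set I}) (a : I -> R) :=
  forall x c, supported S x -> D x c -> \sum_i a i * x i <= c.

(** The classical one-dimensional step: the coefficient at k must lie above all
A x - c with x_k = -1 and below all c - A x with x_k = 1, where p(x) <= c. Adding
such a pair of vectors cancels the coordinate k, so the domination on S shows that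
every lower bound is below every upper bound. *)
Lemma dominated_extend1 (S : {set I}) a k : k \notin S -> dominated_on S a ->
  exists b, {in S, b =1 a} /\ dominated_on (k |: S) b.
Proof.
move=> kS domS; pose A x := \sum_(j | j != k) a j * x j.
have A_add x y : A (fun i => x i + y i) = A x + A y.
  by rewrite -big_split; apply: eq_bigr => j _; rewrite mulrDr.
have A_scale t x : A (fun i => t * x i) = t * A x.
  by rewrite mulr_sumr; apply: eq_bigr => j _; rewrite mulrCA.
have domA x c : supported (k |: S) x -> x k = 0 -> D x c -> A x <= c.
  move=> sx xk Dx; have := domS x c _ Dx; rewrite (bigD1 k) //= xk mulr0 add0r.
  apply=> i iS; have [->|ik] := eqVneq i k; first by [].
  by apply: sx; rewrite !inE negb_or ik.
pose low := [set r | exists x c,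
  [/\ supported (k |: S) x, x k = -1, D x c & r = A x - c]].
have low_le x c r : supported (k |: S) x -> x k = 1 -> D x c -> low r ->
    r <= c - A x.
  move=> sx xk Dx [y [d [sy yk Dy ->]]].
  suff : A (fun i => x i + y i) <= c + d by rewrite A_add; lra.
  apply: domA (D_add Dx Dy) => [i iS|].
    by rewrite sx ?sy ?addr0.
  by rewrite xk yk subrr.
pose e t i : R := if i == k then t else 0.
have se t : supported (k |: S) (e t).
  by move=> i; rewrite !inE negb_or /e => /andP[/negPf->].
have ek t : e t k = t by rewrite /e eqxx.
have [c1 D1] := D_exists (e 1); have [c2 D2] := D_exists (e (-1)).
have low0 : low !=set0 by exists (A (e (-1)) - c2), (e (-1)), c2.
have lowub : has_ubound low.
  by exists (c1 - A (e 1)) => r; apply: low_le D1; rewrite ?ek.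
pose b i := if i == k then sup low else a i.
have bE x : \sum_i b i * x i = sup low * x k + A x.
  rewrite (bigD1 k) //= /b eqxx; congr (_ + _).
  by apply: eq_bigr => i /negPf ->.
exists b; split=> [i iS|x c sx Dx].
  by rewrite /b; case: eqP => // ik; rewrite -ik iS in kS.
rewrite bE; have s_scale t : supported (k |: S) (fun i => t * x i).
  by move=> i iS; rewrite sx ?mulr0.
(* Rescaling reduces to the coordinates x_k = -1, 0 and 1. *)
case: (ltgtP (x k) 0) => [xk|xk|xk]; last by rewrite xk mulr0 add0r domA.
- have t0 : 0 < (- x k)^-1 by rewrite invr_gt0 oppr_gt0.
  have : A (fun i => (- x k)^-1 * x i) - (- x k)^-1 * c <= sup low.
    apply: ub_le_sup => //; exists (fun i => (- x k)^-1 * x i), ((- x k)^-1 * c).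
    split=> //; last exact: D_scale.
    by rewrite invrN mulNr mulVf // lt_eqF.
  rewrite A_scale -mulrBr ler_pdivrMl ?oppr_gt0 //; lra.
- have t0 : 0 < (x k)^-1 by rewrite invr_gt0.
  have : sup low <= (x k)^-1 * c - A (fun i => (x k)^-1 * x i).
    apply: ge_sup => // r; apply: low_le => //; last exact: D_scale.
    by rewrite mulVf // gt_eqF.
  by rewrite A_scale -mulrBr mulrC ler_pdivlMr //; lra.
Qed.

(** The Hahn-Banach theorem in coordinates: the subspace is spanned by the basis
vectors in S, so that the form can be extended one coordinate at a time. *)
Theorem dominated_extend (S : {set I}) a : dominated_on S a ->
  exists b, {in S, b =1 a} /\ forall x c, D x c -> \sum_i b i * x i <= c.
Proof.
have [m] := ubnP #|~: S|; elim: m S a => // m IHm S a.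
rewrite ltnS => leS domS; have [[k kS]|Sfull] := pselect (exists k, k \notin S).
  have [b [ba domb]] := dominated_extend1 kS domS.
  have [|b' [b'b domb']] := IHm _ b _ domb.
    have -> : (~: (k |: S) = (~: S) :\ k)%SET by apply/setP => i; rewrite !inE negb_or.
    by rewrite (cardsD1 k) inE kS in leS.
  exists b'; split=> // i iS.
  by rewrite b'b ?ba // !inE iS orbT.
exists a; split=> // x c; apply: domS => i iS.
by case: Sfull; exists i.
Qed.
End HahnBanach.

(** * Semidefinite programs *)

Lemma bilin_bounded (R : realType) n (A : 'M[R]_n) :
  exists c, forall u, bilin A u u <= c * sqnorm u.
Proof.
exists (\sum_i \sum_j `|A i j|) => u; rewrite bilinE mulr_suml ler_sum // => i _.
rewrite mulr_suml ler_sum // => j _.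
have le_sq k : u k 0 ^+ 2 <= sqnorm u.
  by rewrite sqnormE (bigD1 k) //= lerDl sumr_ge0 // => l _; rewrite sqr_ge0.
have uv : `|u i 0| * `|u j 0| <= sqnorm u.
  have := le_sq i; have := le_sq j; rewrite -[u i 0 ^+ 2]real_normK ?num_real //.
  rewrite -[u j 0 ^+ 2]real_normK ?num_real //.
  have := sqr_ge0 (`|u i 0| - `|u j 0|); rewrite sqrrB; lra.
rewrite mulrAC mulrC (le_trans (ler_norm _)) // !normrM.
by rewrite ler_wpM2l.
Qed.

Lemma psdmxP (R : realType) n (X : 'M[R]_n) :
  psdmx X <-> X^T = X /\ forall u, 0 <= bilin X u u.
Proof. by split=> -[symX psdX]; split=> //; apply/symmetricmxP. Qed.

Lemma psdmx_outer (R : realType) n (w : 'cV[R]_n) : psdmx (w *m w^T).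
Proof.
apply/psdmxP; split=> [|u]; first by rewrite trmx_mul trmxK.
rewrite /bilin mulmxA -mulmxA -[w^T *m u]trmxK trmx_mul trmxK.
by rewrite mxE big_ord1 [(u^T *m w)^T 0 0]mxE -expr2 sqr_ge0.
Qed.

Lemma mxtrace_outer (R : realType) n (w : 'cV[R]_n) : \tr (w *m w^T) = sqnorm w.
Proof. by rewrite mxtrace_mulC /mxtrace big_ord1. Qed.

Lemma mxtrace_mulE (R : realType) n (A B : 'M[R]_n) :
  B^T = B -> \tr (A *m B) = \sum_i \sum_j B i j * A i j.
Proof.
move=> symB; apply: eq_bigr => i _; rewrite mxE; apply: eq_bigr => j _.
by rewrite -{1}symB mxE mulrC.
Qed.

Section H1Attained.
Variables (R : realType) (W : finType) (H : bigraph W).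
Hypothesis W0 : (0 < #|W|)%N.
Let C : 'M[R]_#|W| := bipmx R H.
Let h : R := h1 R H.

(** The matrix with a single entry 1 on the diagonal is feasible, and its value is 0
as the objective vanishes on the diagonal. *)
Lemma h1_values0 : h1_values R H 0.
Proof.
pose i : 'I_#|W| := Ordinal W0; pose e : 'cV[R]_#|W| := delta_mx i 0.
have eE : e *m e^T = delta_mx i i by rewrite trmx_delta mul_delta_mx.
exists (e *m e^T).
  split=> [||x y Hxy]; first exact: psdmx_outer.
    by rewrite mxtrace_outer /sqnorm trmx_delta mul_delta_mx mxE.
  rewrite eE mxE; case: eqP => // xi; case: eqP => // yi.
  by move: Hxy; rewrite -[x]enum_rankK -[y]enum_rankK xi yi adj_irr.
rewrite mxtrace_mulC -mulmxA mxtrace_mulC /mxtrace big_ord1 -[LHS]/(bilin C e e).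
by rewrite /bilin trmx_delta -rowE -colE !mxE eqxx.
Qed.

Lemma h1_ubound : has_ubound (h1_values R H).
Proof.
have [c Cc] := bilin_bounded C; exists c => _ [X [Xpsd X1 _] <-].
by rewrite -[c]mulr1 -X1; apply: mxtrace_mul_psd_le.
Qed.

Lemma h1_ge r : h1_values R H r -> r <= h.
Proof. by apply: ub_le_sup; exact: h1_ubound. Qed.

Lemma h1_le c : (forall r, h1_values R H r -> r <= c) -> h <= c.
Proof. by move=> cP; apply: ge_sup => //; exists 0; apply: h1_values0. Qed.

(** The form t h on the matrices t C + N, with N supported on the edges, is at most
every c with u^T (t C + N) u <= c |u|^2, by the definition of h. Extended to all
N, it is t h + <X, N>, and X is optimal: testing on -u u^T gives positivity, on I
and -I the trace, and on C - C with either sign the value; the zero pattern is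
that of the form being extended. The coordinate t is kept separate from the
entries of N, so that the domain of the form is a coordinate subspace and the form
is well defined even if C is itself supported on the edges. *)
Theorem h1_attained : h1_values R H h.
Proof.
pose n := #|W|; pose I : finType := ('I_1 + 'I_n * 'I_n)%type.
pose Y (x : I -> R) : 'M[R]_n :=
  x (inl 0) *: C + \matrix_(i, j) x (inr (i, j)).
pose D x c := forall u, bilin (Y x) u u <= c * sqnorm u.
pose S : {set I} := [set o | if o is inr (i, j)
  then H (enum_val i) (enum_val j) else true]%SET.
pose a (o : I) : R := if o is inl _ then h else 0.
have sumI (b x : I -> R) : \sum_o b o * x o = b (inl 0) * x (inl 0) +
    \sum_i \sum_j b (inr (i, j)) * x (inr (i, j)).
  by rewrite big_sumType big_ord1 pair_bigA; congr (_ + _); apply: eq_bigr => -[].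
have [||||b [ba bD]] := @dominated_extend R I D _ _ _ S a.
- move=> x y c d Dx Dy u; rewrite mulrDl.
  have -> : Y (fun i => x i + y i) = Y x + Y y.
    by apply/matrixP => i j; rewrite !mxE; ring.
  by rewrite bilin_addmx lerD.
- move=> t x c t0 Dx u.
  have -> : Y (fun i => t * x i) = t *: Y x.
    by apply/matrixP => i j; rewrite !mxE; ring.
  by rewrite bilin_scalemx -mulrA ler_wpM2l // ltW.
- by move=> x; exact: bilin_bounded.
- move=> x c xS Dx; rewrite sumI /= big1 ?addr0 => [|i _]; last first.
    by rewrite big1 // => j _; rewrite mul0r.
  have feas r : h1_values R H r -> r * x (inl 0) <= c.
    move=> [X [Xpsd X1 XF] <-].
    have symX : X^T = X by case/psdmxP: Xpsd.
    rewrite -[c]mulr1 -X1; apply: le_trans (mxtrace_mul_psd_le Xpsd Dx).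
    rewrite mulrC /Y mulmxDl linearD /= -scalemxAl linearZ /= lerDl.
    rewrite mxtrace_mulE // sumr_ge0 // => i _; rewrite sumr_ge0 // => j _.
    rewrite mxE; case: (boolP (H (enum_val i) (enum_val j))) => Hij.
      by have := XF _ _ Hij; rewrite !enum_valK => ->; rewrite mul0r.
    by rewrite xS ?mulr0 // inE.
  (* For t < 0 one feasible value is enough; for t > 0 all of them are needed. *)
  have [t0|t0] := lerP 0 (x (inl 0)); last first.
    rewrite -ler_ndivrMr //; apply: le_trans (h1_ge h1_values0).
    by have := feas _ h1_values0; rewrite mul0r ler_ndivrMr // mul0r.
  have [->|t1] := eqVneq (x (inl 0)) 0.
    by rewrite mulr0; have := feas _ h1_values0; rewrite mul0r.
  have t2 : 0 < x (inl 0) by rewrite lt_def t1.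
  rewrite -ler_pdivlMr //; apply: h1_le => r /feas.
  by rewrite ler_pdivlMr.
have bh : b (inl 0) = h by rewrite ba // inE.
pose X : 'M[R]_n := \matrix_(i, j) b (inr (i, j)).
have XE i j : X i j = b (inr (i, j)) by rewrite mxE.
clearbody X.
have XD t (N : 'M[R]_n) c : (forall u, bilin (t *: C + N) u u <= c * sqnorm u) ->
    h * t + \sum_i \sum_j X i j * N i j <= c.
  move=> cP; pose x (o : I) := if o is inr (i, j) then N i j else t.
  have Yx : Y x = t *: C + N by apply/matrixP => i j; rewrite !mxE.
  have Dx : D x c by rewrite /D Yx.
  have := bD x c Dx; rewrite sumI bh /=; congr (_ + _ <= _); apply: eq_bigr => i _.
  by apply: eq_bigr => j _; rewrite XE.
have XN (N : 'M[R]_n) c : (forall u, bilin N u u <= c * sqnorm u) ->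
    \sum_i \sum_j X i j * N i j <= c.
  by move=> cP; have := XD 0 N c; rewrite mulr0 add0r scale0r add0r; apply.
have symX : X^T = X.
  (* The quadratic form of an antisymmetric matrix vanishes, so <X, .> does too. *)
  have le_X i j : X i j <= X j i.
    have sumd k l : \sum_i \sum_j X i j * delta_mx k l i j = X k l.
      rewrite (bigD1 k) //= (bigD1 l) //= mxE !eqxx mulr1 !big1 ?addr0 //.
        by move=> p /negPf pk; rewrite big1 // => q _; rewrite mxE pk mulr0.
      by move=> q /negPf ql; rewrite mxE ql andbF mulr0.
    rewrite -subr_le0.
    have <- : \sum_k \sum_l X k l * (delta_mx i j - delta_mx j i : 'M[R]_n) k l =
              X i j - X j i.
      rewrite -!sumd -sumrB; apply: eq_bigr => k _; rewrite -sumrB.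
      by apply: eq_bigr => l _; rewrite !mxE mulrBr.
    apply: XN => u; rewrite mul0r -scaleN1r bilin_addmx bilin_scalemx.
    have db k l : bilin (delta_mx k l) u u = u k 0 * u l 0.
      have -> : delta_mx k l = (delta_mx k 0 : 'cV[R]_n) *m (delta_mx 0 l : 'rV[R]_n).
        by rewrite mul_delta_mx.
      rewrite /bilin mulmxA -mulmxA -colE -rowE mxE big_ord1.
      by rewrite !mxE.
    by rewrite !db mulN1r mulrC subrr.
  by apply/matrixP => i j; rewrite mxE; apply/eqP; rewrite eq_le !le_X.
have bilin1 u : bilin 1%:M u u = sqnorm u by rewrite /bilin mulmx1.
have tr1 : \tr X = 1.
  have trE (s : R) : \sum_i \sum_j X i j * (s%:M : 'M[R]_n) i j = s * \tr X.
    rewrite mulr_sumr; apply: eq_bigr => i _; rewrite (bigD1 i) //= big1.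
      by rewrite mxE eqxx addr0 mulrC.
    by move=> j ji; rewrite mxE eq_sym (negPf ji) mulr0.
  have tr_le s : s * \tr X <= s.
    by rewrite -trE; apply: XN => u; rewrite -scalemx1 bilin_scalemx bilin1.
  by have := tr_le 1; have := tr_le (-1); lra.
exists X.
  split=> // [|x y Hxy].
    apply/psdmxP; split=> // u; rewrite bilinE -oppr_le0.
    have -> : - (\sum_i \sum_j u i 0 * X i j * u j 0) =
              \sum_i \sum_j X i j * (- (u *m u^T)) i j.
      rewrite -sumrN; apply: eq_bigr => i _; rewrite -sumrN.
      by apply: eq_bigr => j _; rewrite !mxE big_ord1 mxE; ring.
    apply: XN => v; rewrite mul0r -scaleN1r bilin_scalemx mulN1r oppr_le0.
    by case/psdmxP: (psdmx_outer u).
  by rewrite XE ba // inE !enum_rankK.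
rewrite mxtrace_mulE //.
have bilin0 (v : 'cV[R]_n) : bilin 0 v v <= 0 * sqnorm v.
  by rewrite /bilin mulmx0 mul0mx mxE mul0r.
have le_h : h * -1 + \sum_i \sum_j X i j * C i j <= 0.
  by apply: XD => u; rewrite scaleN1r addNr.
have ge_h : h * 1 + \sum_i \sum_j X i j * (- C) i j <= 0.
  by apply: XD => u; rewrite scale1r subrr.
have sumN : \sum_i \sum_j X i j * (- C) i j = - \sum_i \sum_j X i j * C i j.
  rewrite -sumrN; apply: eq_bigr => i _; rewrite -sumrN.
  by apply: eq_bigr => j _; rewrite mxE mulrN.
by move: ge_h; rewrite sumN; lra.
Qed.
End H1Attained.

Lemma psdmx_add (R : realType) n (X Y : 'M[R]_n) :
  psdmx X -> psdmx Y -> psdmx (X + Y).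
Proof.
move=> /psdmxP[symX pX] /psdmxP[symY pY]; apply/psdmxP; split=> [|u].
  by rewrite linearD /= symX symY.
by rewrite bilin_addmx addr_ge0.
Qed.

Lemma psdmx_scale (R : realType) n t (X : 'M[R]_n) :
  0 <= t -> psdmx X -> psdmx (t *: X).
Proof.
move=> t0 /psdmxP[symX pX]; apply/psdmxP; split=> [|u].
  by rewrite linearZ /= symX.
by rewrite bilin_scalemx mulr_ge0.
Qed.

Lemma psdmx_trace_ge0 (R : realType) n (X : 'M[R]_n) : psdmx X -> 0 <= \tr X.
Proof.
move=> psdX; rewrite -oppr_le0 -mulN1r -[X]mul1mx -mxtraceZ scalemxAl.
rewrite -[0](mul0r (\tr X)); apply: mxtrace_mul_psd_le => // u.
by rewrite bilin_scalemx /bilin mulmx1 mulN1r mul0r oppr_le0 sqnorm_ge0.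
Qed.

(** The homogeneous form of the program; if the trace is 0, the left-hand side is 0
too because the quadratic form of the objective is bounded. *)
Lemma h1_trace_le (R : realType) (W : finType) (H : bigraph W) (X : 'M[R]_#|W|) :
  (0 < #|W|)%N -> psdmx X ->
  (forall i j, H i j -> X (enum_rank i) (enum_rank j) = 0) ->
  \tr (bipmx R H *m X) <= h1 R H * \tr X.
Proof.
move=> W0 psdX XF; have := psdmx_trace_ge0 psdX; rewrite le_eqVlt.
case/predU1P => [tr0|tr0].
  have [c cP] := bilin_bounded (bipmx R H).
  by have := mxtrace_mul_psd_le psdX cP; rewrite -tr0 !mulr0.
rewrite -ler_pdivrMr // mulrC; apply: h1_ge => //.
exists ((\tr X)^-1 *: X); last by rewrite -scalemxAr mxtraceZ.
split=> [||i j Hij].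
- by apply: psdmx_scale => //; rewrite invr_ge0 ltW.
- by rewrite mxtraceZ mulVf // gt_eqF.
- by rewrite mxE XF ?mulr0.
Qed.

(** * The double graph and phi *)

Section Duality.
Variables (R : realType) (V : finType) (G : graph V).
Hypothesis V0 : (0 < #|V|)%N.
Let n := #|V|.
Let m := #|{: V + V}|.
Let h : R := h1 R (B0 G).

(** The indices of the two copies of a vertex in a matrix indexed by V + V. *)
Definition inl_rank (i : 'I_n) : 'I_m := enum_rank (inl (enum_val i)).
Definition inr_rank (i : 'I_n) : 'I_m := enum_rank (inr (enum_val i)).

Lemma sum_enum_rank (T : finType) (F : 'I_#|T| -> R) :
  \sum_i F i = \sum_(x : T) F (enum_rank x).
Proof. by rewrite (reindex _ (onW_bij _ (@enum_rank_bij T))). Qed.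

Lemma sum_double (F : 'I_m -> R) :
  \sum_i F i = \sum_i F (inl_rank i) + \sum_i F (inr_rank i).
Proof.
rewrite sum_enum_rank big_sumType /=.
by congr (_ + _); rewrite sum_enum_rank; apply: eq_bigr => x _;
  rewrite /inl_rank /inr_rank enum_rankK.
Qed.

(** The block matrix with zero diagonal blocks and off-diagonal blocks M and M^T. *)
Definition cross_mx (M : 'M[R]_n) : 'M[R]_m := \matrix_(i, j)
  match enum_val i, enum_val j with
  | inl x, inr y => M (enum_rank x) (enum_rank y)
  | inr y, inl x => M (enum_rank x) (enum_rank y)
  | _, _ => 0
  end.

Definition join_cV (u v : 'cV[R]_n) : 'cV[R]_m := \col_i
  match enum_val i with
  | inl x => u (enum_rank x) 0
  | inr x => v (enum_rank x) 0
  end.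

Lemma cross_mxE M i j :
  [/\ cross_mx M (inl_rank i) (inl_rank j) = 0,
      cross_mx M (inl_rank i) (inr_rank j) = M i j,
      cross_mx M (inr_rank j) (inl_rank i) = M i j &
      cross_mx M (inr_rank i) (inr_rank j) = 0].
Proof. by rewrite !mxE !enum_rankK !enum_valK. Qed.

Lemma cross_mx_sym M : (cross_mx M)^T = cross_mx M.
Proof.
by apply/matrixP => i j; rewrite !mxE; case: enum_val => x; case: enum_val.
Qed.

Lemma join_cVE u v i :
  join_cV u v (inl_rank i) 0 = u i 0 /\ join_cV u v (inr_rank i) 0 = v i 0.
Proof. by rewrite !mxE !enum_rankK !enum_valK. Qed.

Lemma join_cV_surj (w : 'cV[R]_m) : exists u v, w = join_cV u v.
Proof.
exists (\col_i w (inl_rank i) 0), (\col_i w (inr_rank i) 0).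
apply/colP => i; rewrite !mxE; case: (enum_val i) (enum_valK i) => x <-.
  by rewrite mxE /inl_rank enum_rankK.
by rewrite mxE /inr_rank enum_rankK.
Qed.

Lemma sqnorm_join u v : sqnorm (join_cV u v) = sqnorm u + sqnorm v.
Proof.
rewrite !sqnormE sum_double.
by congr (_ + _); apply: eq_bigr => i _; have [jl jr] := join_cVE u v i;
  rewrite ?jl ?jr.
Qed.

Lemma bilin_cross M u v :
  bilin (cross_mx M) (join_cV u v) (join_cV u v) = 2 * bilin M u v.
Proof.
rewrite !bilinE sum_double mulrDl mul1r; congr (_ + _).
  apply: eq_bigr => i _; rewrite sum_double big1 ?add0r => [|j _].
    apply: eq_bigr => j _; have [_ -> _ _] := cross_mxE M i j.
    by have [-> _] := join_cVE u v i; have [_ ->] := join_cVE u v j.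
  by have [-> _ _ _] := cross_mxE M i j; rewrite mulr0 mul0r.
rewrite exchange_big sum_double [X in _ + X]big1 ?addr0 => [|j _].
  apply: eq_bigr => i _; apply: eq_bigr => j _.
  have [_ _ -> _] := cross_mxE M i j.
  have [-> _] := join_cVE u v i; have [_ ->] := join_cVE u v j.
  by ring.
by rewrite big1 // => i _; have [_ _ _ ->] := cross_mxE M i j; rewrite mulr0 mul0r.
Qed.

Lemma mxtrace_cross M (X : 'M[R]_m) : X^T = X ->
  \tr (cross_mx M *m X) =
  2 * \sum_i \sum_j X (inl_rank i) (inr_rank j) * M i j.
Proof.
move=> symX; rewrite mxtrace_mulE // sum_double mulrDl mul1r; congr (_ + _).
  apply: eq_bigr => i _; rewrite sum_double big1 ?add0r => [|j _].
    by apply: eq_bigr => j _; have [_ -> _ _] := cross_mxE M i j.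
  by have [-> _ _ _] := cross_mxE M i j; rewrite mulr0.
rewrite exchange_big sum_double [X in _ + X]big1 ?addr0 => [|j _].
  apply: eq_bigr => i _; apply: eq_bigr => j _.
  by have [_ _ -> _] := cross_mxE M i j; rewrite -[in LHS]symX mxE.
by rewrite big1 // => i _; have [_ _ _ ->] := cross_mxE M i j; rewrite mulr0.
Qed.

Lemma bipmx_B0 : bipmx R (B0 G) = 2^-1 *: cross_mx (const_mx 1).
Proof.
apply/matrixP => i j; rewrite !mxE /=.
by case: (enum_val i) => x; case: (enum_val j) => y; rewrite /= ?mxE ?mulr0 ?mulr1.
Qed.

Lemma mxtrace_bipmx_B0 (X : 'M[R]_m) : X^T = X ->
  \tr (bipmx R (B0 G) *m X) = \sum_i \sum_j X (inl_rank i) (inr_rank j).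
Proof.
move=> symX; rewrite bipmx_B0 -scalemxAl mxtraceZ mxtrace_cross // mulKf ?pnatr_eq0 //.
by apply: eq_bigr => i _; apply: eq_bigr => j _; rewrite mxE mulr1.
Qed.

Lemma B0_compl (i j : 'I_n) :
  B0 G (inl (enum_val i)) (inr (enum_val j)) =
  ~~ compl G (enum_val i) (enum_val j).
Proof. by rewrite /= /compl_adj negb_and !negbK. Qed.

Lemma double_gt0 : (0 < m)%N.
Proof. by rewrite /m card_sum addn_gt0 V0. Qed.

(** The trace pairing of X with the objective is half of that with [cross_mx M],
because X vanishes wherever M may differ from 1. The quadratic form of
[cross_mx M] at (u, v) is 2 u^T M v, bounded by polarisation. *)
Lemma h1_weak_duality (M : 'M[R]_n) : M^T = M ->
  (forall i j, compl G i j -> M (enum_rank i) (enum_rank j) = 1) ->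
  2 * h <= lambda_abs M.
Proof.
move=> symM M1; rewrite mulrC -ler_pdivlMr //.
apply: h1_le => [|_ [X [psdX X1 XF] <-]]; first exact: double_gt0.
have symX : X^T = X by case/psdmxP: psdX.
have -> : \tr (bipmx R (B0 G) *m X) = 2^-1 * \tr (cross_mx M *m X).
  rewrite mxtrace_bipmx_B0 // mxtrace_cross // mulKf ?pnatr_eq0 //.
  apply: eq_bigr => i _; apply: eq_bigr => j _.
  case: (boolP (compl G (enum_val i) (enum_val j))) => Gij.
    by have := M1 _ _ Gij; rewrite !enum_valK => ->; rewrite mulr1.
  by rewrite /inl_rank /inr_rank XF ?mul0r // B0_compl.
rewrite mulrC ler_wpM2r ?invr_ge0 //.
rewrite -[lambda_abs M]mulr1 -X1; apply: mxtrace_mul_psd_le => // w.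
have [u [v ->]] := join_cV_surj w; rewrite bilin_cross sqnorm_join.
have bvu : bilin M v u = bilin M u v by rewrite -[in RHS]symM bilin_tr.
have := lambda_abs_bound (u + v) symM; have := lambda_abs_bound (u - v) symM.
rewrite !sqnorm_bilin !bilinD !bilinN bvu !ler_norml.
by move=> /andP[l1 l2] /andP[l3 l4]; lra.
Qed.

(** The sublinear functional is p(B) = h * (least trace of a positive semidefinite
matrix with off-diagonal block B), a multiple of the nuclear norm of B. *)
Lemma h1_strong_duality : exists M : 'M[R]_n,
  [/\ M^T = M,
      forall i j, compl G i j -> M (enum_rank i) (enum_rank j) = 1 &
      lambda_abs M <= 2 * h].
Proof.
pose D (x : 'I_n * 'I_n -> R) c := exists X : 'M[R]_m,
  [/\ psdmx X, forall i j, X (inl_rank i) (inr_rank j) = x (i, j) &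
      h * \tr X <= c].
pose S : {set 'I_n * 'I_n} := [set ij | compl G (enum_val ij.1) (enum_val ij.2)]%SET.
have [||||b [b1 bD]] := @dominated_extend R ('I_n * 'I_n)%type D _ _ _ S (fun=> 1).
- move=> x y c d [X [pX Xx Xc]] [Y [pY Yy Yd]]; exists (X + Y); split.
  + exact: psdmx_add.
  + by move=> i j; rewrite mxE Xx Yy.
  + by rewrite linearD /= mulrDr lerD.
- move=> t x c t0 [X [pX Xx Xc]]; exists (t *: X); split.
  + by apply: psdmx_scale => //; exact: ltW.
  + by move=> i j; rewrite mxE Xx.
  + by rewrite mxtraceZ mulrCA ler_wpM2l // ltW.
- move=> x; pose A := cross_mx (\matrix_(i, j) x (i, j)).
  (* A large multiple of the identity makes the block matrix of x semidefinite. *)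
  have [c cP] := bilin_bounded (- A); pose X := A + c%:M.
  exists (h * \tr X), X; split=> //.
    apply/psdmxP; split=> [|u].
      by rewrite /X linearD /= tr_scalar_mx cross_mx_sym.
    have := cP u; rewrite -scaleN1r /X bilin_scalemx bilin_addmx -scalemx1.
    rewrite bilin_scalemx.
    rewrite /bilin mulmx1 -/(sqnorm u); lra.
  move=> i j; rewrite mxE; have [_ -> _ _] := cross_mxE (\matrix_(i, j) x (i, j)) i j.
  rewrite !mxE; have /negPf -> : inl_rank i != inr_rank j.
    by apply/eqP => /enum_rank_inj.
  by rewrite mulr0n addr0.
- move=> x c xS [X [pX Xx]]; apply: le_trans.
  have symX : X^T = X by case/psdmxP: pX.
  apply: le_trans (h1_trace_le double_gt0 pX _); last first.
    have XF x1 y1 : ~~ compl G x1 y1 -> X (enum_rank (inl x1)) (enum_rank (inr y1)) = 0.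
      move=> xy; rewrite -[x1]enum_rankK -[y1]enum_rankK Xx xS // inE /=.
      by rewrite !enum_rankK.
    case=> x1 [] y1 // Bxy; last rewrite -symX mxE;
      by apply: XF; rewrite /= /compl_adj negb_and !negbK // eq_sym adj_sym.
  rewrite mxtrace_bipmx_B0 // pair_bigA /=; apply: ler_sum => -[i j] _.
  by rewrite mul1r Xx.
pose M0 : 'M[R]_n := \matrix_(i, j) b (i, j).
have bound s u : s ^+ 2 = 1 -> s * bilin M0 u u <= 2 * h * sqnorm u.
  (* The block s u u^T comes from the rank-one matrix w w^T. *)
  move=> s2; pose w := join_cV u (s *: u).
  have Dw : D (fun ij => s * (u ij.1 0 * u ij.2 0)) (2 * h * sqnorm u).
    exists (w *m w^T); split=> [|i j|]; first exact: psdmx_outer.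
      rewrite mxE big_ord1 [w^T _ _]mxE.
      have [-> _] := join_cVE u (s *: u) i; have [_ ->] := join_cVE u (s *: u) j.
      by rewrite mxE mulrCA.
    rewrite mxtrace_outer sqnorm_join.
    have -> : sqnorm (s *: u) = sqnorm u.
      by rewrite !sqnormE; apply: eq_bigr => i _; rewrite mxE exprMn s2 mul1r.
    by have -> : 2 * h * sqnorm u = h * (sqnorm u + sqnorm u) by ring.
  have := bD _ _ Dw; congr (_ <= _).
  rewrite bilinE pair_bigA mulr_sumr; apply: eq_bigr => -[i j] _ /=.
  by rewrite mxE; ring.
(* Symmetrising keeps the quadratic form, and the entries 1 as well. *)
exists (2^-1 *: (M0 + M0^T)).
have symM : (2^-1 *: (M0 + M0^T))^T = 2^-1 *: (M0 + M0^T).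
  by rewrite linearZ linearD /= trmxK addrC.
split=> // [x y xy|].
  rewrite !mxE !b1 ?inE ?enum_rankK //=; first by field.
  by rewrite -[compl_adj _ _ _]/(compl G y x) adj_sym.
apply: lambda_abs_le => // u.
have -> : bilin (2^-1 *: (M0 + M0^T)) u u = bilin M0 u u.
  rewrite bilin_scalemx bilin_addmx.
  have -> : bilin M0^T u u = bilin M0 u u.
    exact: bilin_tr.
  by field.
have := bound 1 u (expr1n _ _); have := bound (-1) u (sqrr_sign R 1).
rewrite ler_norml => l1 l2; apply/andP; split; lra.
Qed.

Theorem phi_compl_spec : phi_values R (compl G) (phi R (compl G)) /\
  h = phi R (compl G) / 2.
Proof.
have [M [symM M1 Mle]] := h1_strong_duality.
have eM : lambda_abs M = 2 * h.
  by apply/eqP; rewrite eq_le Mle h1_weak_duality.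
have valM : phi_values R (compl G) (2 * h).
  by exists M => //; split=> //; apply/symmetricmxP.
suff e : phi R (compl G) = 2 * h by rewrite e; split=> //; field.
have lbM : lbound (phi_values R (compl G)) (2 * h).
  by move=> _ [N [/symmetricmxP symN N1] <-]; apply: h1_weak_duality.
apply/eqP; rewrite eq_le; apply/andP; split.
  by apply: ge_inf => //; exists (2 * h).
by apply: lb_le_inf => //; exists (2 * h).
Qed.
End Duality.

(** * The Laplacian spectrum *)

Section Laplacian.
Variables (R : realType) (V : finType) (G : graph V).
Hypothesis V1 : (1 < #|V|)%N.
Let n := #|V|.
Let g (i j : 'I_n) : R := (G (enum_val i) (enum_val j))%:R.
Let L : 'M[R]_n := laplacian R G.
Let mu := eigenvalues L.
Let one : 'cV[R]_n := const_mx 1.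

Lemma degmx_sum (i : 'I_n) :
  #|[set y | G (enum_val i) y]%SET|%:R = \sum_j g i j :> R.
Proof.
rewrite sum_enum_rank -sum1dep_card natr_sum big_mkcond /=.
by apply: eq_bigr => y _; rewrite /g enum_rankK; case: (G _ _).
Qed.

Lemma laplacianE i j : L i j = (\sum_k g i k) *+ (i == j) - g i j.
Proof. by rewrite /L /laplacian !mxE degmx_sum. Qed.

Lemma g_sym i j : g i j = g j i. Proof. by rewrite /g adj_sym. Qed.

Lemma laplacian_sym : L^T = L.
Proof.
apply/matrixP => i j; rewrite mxE !laplacianE eq_sym g_sym; congr (_ - _).
by case: eqP => // ->.
Qed.

Lemma laplacian_mul (u : 'cV[R]_n) i :
  (L *m u) i 0 = \sum_j g i j * (u i 0 - u j 0).
Proof.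
rewrite mxE; under eq_bigr do rewrite laplacianE mulrBl.
rewrite sumrB.
have -> : \sum_j (\sum_k g i k) *+ (i == j) * u j 0 = (\sum_k g i k) * u i 0.
  rewrite (bigD1 i) //= eqxx mulr1n [X in _ + X]big1 ?addr0 // => j /negPf ji.
  by rewrite eq_sym ji mul0r.
by rewrite mulr_suml -sumrB; apply: eq_bigr => j _; rewrite mulrBr.
Qed.

Lemma laplacian_one : L *m one = 0.
Proof.
apply/colP => i; rewrite laplacian_mul !mxE big1 // => j _.
by rewrite !mxE subrr mulr0.
Qed.

Lemma laplacian_psd u : 0 <= bilin L u u.
Proof.
have e : bilin L u u = \sum_i \sum_j g i j * (u i 0 ^+ 2 - u i 0 * u j 0).
  rewrite bilin_col; apply: eq_bigr => i _; rewrite laplacian_mul mulr_sumr.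
  by apply: eq_bigr => j _; ring.
have e' : bilin L u u = \sum_i \sum_j g i j * (u j 0 ^+ 2 - u i 0 * u j 0).
  rewrite e exchange_big; apply: eq_bigr => i _; apply: eq_bigr => j _.
  by rewrite g_sym [u j 0 * _]mulrC.
rewrite -(pmulr_rge0 _ (ltr0n R 2)) mulr_natl mulr2n {1}e e' -big_split.
apply: sumr_ge0 => i _; rewrite -big_split; apply: sumr_ge0 => j _ /=.
have -> : g i j * (u i 0 ^+ 2 - u i 0 * u j 0) + g i j * (u j 0 ^+ 2 - u i 0 * u j 0) =
          g i j * (u i 0 - u j 0) ^+ 2 by ring.
by rewrite mulr_ge0 ?sqr_ge0 // ler0n.
Qed.

Section Eigenbasis.
Variable P : 'M[R]_n.
Hypothesis PP : P *m P^T = 1%:M.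
Hypothesis sorted_mu : sorted <=%R mu.
Hypothesis size_mu : size mu = n.
Hypothesis LP : L = P^T *m diag_mx (\row_i mu`_i) *m P.

Let i0 : 'I_n := Ordinal (ltnW V1).
Let i1 : 'I_n := Ordinal V1.

Let eigvec i : 'cV[R]_n := P^T *m delta_mx i 0.

Lemma bilin_laplacian u : bilin L u u = \sum_(i < n) mu`_i * (P *m u) i 0 ^+ 2.
Proof.
by rewrite LP bilin_diag; apply: eq_bigr => i _; rewrite mxE expr2.
Qed.

Lemma laplacian_coord (u : 'cV[R]_n) (i : 'I_n) :
  (P *m (L *m u)) i 0 = mu`_i * (P *m u) i 0.
Proof. by rewrite LP !mulmxA PP mul1mx -mulmxA mul_diag_mx !mxE. Qed.

Lemma coord_eigenvector (i j : 'I_n) : (P *m (eigvec i)) j 0 = (j == i)%:R.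
Proof. by rewrite /eigvec mulmxA PP mul1mx mxE andbT. Qed.

Lemma laplacian_eigenvector (i : 'I_n) :
  L *m (eigvec i) = mu`_i *: (eigvec i).
Proof.
rewrite /eigvec LP -!mulmxA [P *m _]mulmxA PP mul1mx scalemxAr; congr (_ *m _).
apply/colP => j; rewrite mul_diag_mx !mxE.
by case: eqP => [->|]; rewrite ?andbF ?mulr0.
Qed.

Lemma mu_ge0 (i : 'I_n) : 0 <= mu`_i.
Proof.
have := laplacian_psd (eigvec i); rewrite bilin_laplacian (bigD1 i) //=.
rewrite coord_eigenvector eqxx expr1n mulr1 big1 ?addr0 // => j /negPf ji.
by rewrite coord_eigenvector ji expr0n mulr0.
Qed.

Lemma mu_le (i j : 'I_n) : (i <= j)%N -> mu`_i <= mu`_j.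
Proof.
by move=> ij; apply: (sorted_leq_nth le_trans le_refl) => //; rewrite inE size_mu.
Qed.

Lemma mu_le_last (i : 'I_n) : mu`_i <= mu`_n.-1.
Proof.
have lt : (n.-1 < n)%N by rewrite prednK // ltnW.
by apply: (@mu_le i (Ordinal lt)); rewrite /= -ltnS prednK // ltnW.
Qed.

Lemma coord_one (i : 'I_n) : mu`_i != 0 -> (P *m one) i 0 = 0.
Proof.
move=> mui; have := laplacian_coord one i; rewrite laplacian_one mulmx0 mxE.
by move=> /esym/eqP; rewrite mulf_eq0 (negPf mui) => /eqP.
Qed.

(** If mu_2 > 0, the kernel of L is the line of the first basis vector, so the
constants lie on it and u has no component along it; if mu_2 = 0, the claim is
that L is positive semidefinite. *)
Lemma rayleigh_ge u : (one^T *m u) 0 0 = 0 -> mu`_1 * sqnorm u <= bilin L u u.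
Proof.
move=> u1; have [->|mu1] := eqVneq mu`_1 0; first by rewrite mul0r laplacian_psd.
have mu_neq0 (i : 'I_n) : i != i0 -> mu`_i != 0.
  move=> ii0; rewrite gt_eqF // (@lt_le_trans _ _ mu`_i1) //.
    by rewrite lt_def mu1 mu_ge0.
  by apply: mu_le => /=; rewrite lt0n; apply: contra ii0 => /eqP i_0; apply/eqP/val_inj.
have p0 : (P *m one) i0 0 != 0.
  apply/eqP => p0; have := sqnorm_orthogonal one PP.
  rewrite !sqnormE big1 => [|i _]; last first.
    have [->|/mu_neq0/coord_one ->] := eqVneq i i0; last by rewrite expr0n.
    by rewrite p0 expr0n.
  move=> /esym/eqP; rewrite psumr_eq0 => [|i _]; last exact: sqr_ge0.
  by move=> /allP/(_ i0 (mem_index_enum _)); rewrite mxE expr1n oner_eq0.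
have u0 : (P *m u) i0 0 = 0.
  have : ((P *m one)^T *m (P *m u)) 0 0 = 0.
    by rewrite trmx_mul mulmxA -[_ *m _ *m P]mulmxA (mulmx1C PP) mulmx1.
  rewrite mxE (bigD1 i0) //= big1 ?addr0 => [|i /mu_neq0/coord_one pi0].
    by rewrite mxE => /eqP; rewrite mulf_eq0 (negPf p0) => /eqP.
  by rewrite mxE pi0 mul0r.
rewrite -(sqnorm_orthogonal u PP) sqnormE bilin_laplacian mulr_sumr.
apply: ler_sum => i _; have [->|ii0] := eqVneq i i0.
  by rewrite u0 expr0n !mulr0.
rewrite ler_wpM2r ?sqr_ge0 //; apply: (@mu_le i1) => /=.
by rewrite lt0n; apply: contra ii0 => /eqP i_0; apply/eqP/val_inj.
Qed.

Lemma rayleigh_le u : bilin L u u <= mu`_n.-1 * sqnorm u.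
Proof.
rewrite -(sqnorm_orthogonal u PP) sqnormE bilin_laplacian mulr_sumr.
by apply: ler_sum => i _; rewrite ler_wpM2r ?sqr_ge0 ?mu_le_last.
Qed.

(** Eigenvectors for nonzero eigenvalues are orthogonal to the constants. If mu_i = 0
then mu_1 = 0 too, and the span of two null vectors of the basis contains a
nonzero vector orthogonal to the constants. *)
Lemma eigenvector_orthogonal_one (i : 'I_n) : (0 < i)%N ->
  exists w : 'cV[R]_n,
    [/\ 0 < sqnorm w, (one^T *m w) 0 0 = 0 & L *m w = mu`_i *: w].
Proof.
move=> i_gt0; pose f j := eigvec j.
have one_f j : (one^T *m f j) 0 0 = (P *m one) j 0.
  by rewrite /f /eigvec mulmxA -[_ *m P^T]trmx_mul -colE !mxE.
have f_gt0 w j : (P *m w) j 0 != 0 -> 0 < sqnorm w.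
  move=> wj; apply: sqnorm_gt0; apply: contra wj => /eqP ->.
  by rewrite mulmx0 mxE.
have [pi0|pi0] := eqVneq ((P *m one) i 0) 0.
  exists (f i); split; [|by rewrite one_f|exact: laplacian_eigenvector].
  by apply: (f_gt0 _ i); rewrite coord_eigenvector eqxx oner_eq0.
have mui : mu`_i = 0 by apply/eqP; apply: contraNT pi0 => /coord_one ->.
have mu0 : mu`_0 = 0.
  apply: le_anti; rewrite (mu_ge0 i0) andbT.
  by have := @mu_le i0 i isT; rewrite mui.
have mul_entry k (A : 'M[R]_(k, n)) a b (x y : 'cV[R]_n) j :
    (A *m (a *: x - b *: y)) j 0 = a * (A *m x) j 0 - b * (A *m y) j 0.
  by rewrite mulmxBr -!scalemxAr; move: (A *m x) (A *m y) => ? ?; rewrite !mxE.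
exists ((P *m one) i 0 *: f i0 - (P *m one) i0 0 *: f i); split.
- apply: (f_gt0 _ i0); rewrite mul_entry !coord_eigenvector eqxx mulr1.
  by rewrite -val_eqE /= (ltn_eqF i_gt0) mulr0 subr0.
- by rewrite mul_entry !one_f mulrC subrr.
- rewrite mui scale0r mulmxBr -!scalemxAr !laplacian_eigenvector mui mu0.
  by rewrite !scale0r !scaler0 subrr.
Qed.
End Eigenbasis.

(** The positions 1 and n - 1 hold mu_2 and mu_n, as lists are indexed from 0. *)
Theorem laplacian_spectrum :
  [/\ 0 <= mu`_1 <= mu`_n.-1,
      forall u, (one^T *m u) 0 0 = 0 -> mu`_1 * sqnorm u <= bilin L u u,
      forall u, bilin L u u <= mu`_n.-1 * sqnorm u &
      forall i, (0 < i < n)%N -> exists w : 'cV[R]_n,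
        [/\ 0 < sqnorm w, (one^T *m w) 0 0 = 0 & L *m w = mu`_i *: w]].
Proof.
have [size_mu sorted_mu [P [PP LP]]] := eigenvalues_spectral laplacian_sym.
split.
- rewrite (mu_ge0 PP LP (Ordinal V1)).
  exact: (mu_le_last sorted_mu size_mu (Ordinal V1)).
- by move=> u; apply: rayleigh_ge LP _.
- by move=> u; apply: rayleigh_le LP _.
- move=> i /andP[i_gt0 lt_in].
  exact: (eigenvector_orthogonal_one PP sorted_mu size_mu LP (i := Ordinal lt_in)).
Qed.

Lemma bilin_ones u : bilin (const_mx 1) u u = (one^T *m u) 0 0 ^+ 2.
Proof.
rewrite bilinE mxE expr2 mulr_suml; apply: eq_bigr => i _.
rewrite mulr_sumr; apply: eq_bigr => j _.
by rewrite !mxE mulr1 !mul1r.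
Qed.

Lemma one_one : (one^T *m one) 0 0 = n%:R.
Proof.
rewrite mxE; under eq_bigr do rewrite !mxE mulr1.
by rewrite sumr_const card_ord.
Qed.

Definition pencil (a b : R) : 'M[R]_n := const_mx 1 - a%:M + b *: L.

Lemma pencilE a b i j : pencil a b i j = 1 - a *+ (i == j) + b * L i j.
Proof. by rewrite /pencil; move: L => L'; rewrite !mxE. Qed.

Lemma pencil_sym a b : (pencil a b)^T = pencil a b.
Proof.
by rewrite linearD linearB linearZ /= trmx_const tr_scalar_mx laplacian_sym.
Qed.

Lemma bilin_pencil a b u : bilin (pencil a b) u u =
  (one^T *m u) 0 0 ^+ 2 - a * sqnorm u + b * bilin L u u.
Proof.
rewrite /pencil -scalemx1 -scaleNr bilin_addmx bilin_addmx !bilin_scalemx.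
by rewrite bilin_ones -sqnorm_bilin mulNr.
Qed.

Lemma cardV_gt0 : 0 < n%:R :> R.
Proof. by rewrite ltr0n ltnW. Qed.

Lemma phiHE : phiH R G = n%:R / 2 * (1 - mu`_1 / mu`_n.-1).
Proof. exact: erefl. Qed.

Lemma bilin_laplacian_shift u a : bilin L (u + a *: one) (u + a *: one) = bilin L u u.
Proof.
have Lone v : bilin L v (a *: one) = 0.
  by rewrite bilinZr /bilin -mulmxA laplacian_one mulmx0 mxE mulr0.
by rewrite bilinD -[bilin L (a *: one) u]bilin_tr laplacian_sym !Lone !addr0.
Qed.

Lemma sqnorm_shift u a : (one^T *m u) 0 0 = 0 ->
  sqnorm (u + a *: one) = sqnorm u + a ^+ 2 * n%:R.
Proof.
move=> u1; have u_one : bilin 1%:M u one = 0.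
  by rewrite -bilin_tr trmx1 /bilin mulmx1 u1.
have one_u : bilin 1%:M one u = 0 by rewrite -bilin_tr trmx1.
have oo : bilin 1%:M one one = n%:R by rewrite -sqnorm_bilin /sqnorm one_one.
by rewrite !sqnorm_bilin bilinD !(bilinZr, bilinZl) u_one one_u oo; ring.
Qed.

Lemma phi_has_lbound : has_lbound (phi_values R (compl G)).
Proof.
exists 0 => _ [M [/symmetricmxP symM _] <-].
have := lambda_abs_bound one symM.
have -> : sqnorm one = n%:R by rewrite /sqnorm one_one.
move=> /(le_trans (normr_ge0 _)).
by rewrite pmulr_lge0 // cardV_gt0.
Qed.

(** Write u = w + (s / n) 1 with w orthogonal to the constants; then the form of the
pencil at u is (n - a) s^2 / n + b w^T L w - a |w|^2, and the three extreme
coefficients n - a, b mu_2 - a and b mu_n - a are c, -c and at most c. *)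
Theorem phi_compl_le_phiH : phi R (compl G) <= phiH R G.
Proof.
have [/andP[mu1 mu1n] Lge Lle _] := laplacian_spectrum.
set m1 := mu`_1 in mu1 mu1n Lge *; set mn := mu`_n.-1 in mu1n Lle *.
pose r := m1 / mn; pose N : R := n%:R; pose b := N / mn; pose a := N / 2 * (1 + r).
have N0 : 0 < N := cardV_gt0.
have mn0 : 0 <= mn by apply: le_trans mu1n.
have r01 : 0 <= r <= 1.
  rewrite divr_ge0 //= /r; have [->|mn1] := eqVneq mn 0; first by rewrite invr0 mulr0.
  by rewrite ler_pdivrMr ?mul1r // lt_def mn1.
have b0 : 0 <= b by rewrite divr_ge0 // ltW.
have bm1 : b * m1 = N * r by rewrite /b /r; ring.
have bmn : b * mn <= N.
  rewrite /b; have [->|mn1] := eqVneq mn 0; first by rewrite mulr0 ltW.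
  by rewrite divfK.
apply: (@le_trans _ _ (lambda_abs (pencil a b))).
  apply: ge_inf; first exact: phi_has_lbound.
  exists (pencil a b) => //; split; first exact/symmetricmxP/pencil_sym.
  move=> x y /andP[xy nGxy].
  rewrite pencilE laplacianE (inj_eq enum_rank_inj) (negPf xy) !mulr0n.
  rewrite /g !enum_rankK (negPf nGxy).
  by rewrite !subr0 mulr0 addr0.
rewrite phiHE -/mu -/m1 -/mn -/r -/N.
apply: lambda_abs_le (pencil_sym a b) _ => [|u]; first exact: ltnW.
rewrite bilin_pencil; set s := (one^T *m u) 0 0; pose w := u - (s / N) *: one.
have one_w : (one^T *m w) 0 0 = 0.
  have -> : (one^T *m w) 0 0 = s - s / N * (one^T *m one) 0 0.
    rewrite mulmxBr -scalemxAr /s.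
    by move: (one^T *m u) (one^T *m one) => ? ?; rewrite !mxE.
  by rewrite one_one divfK ?subrr // gt_eqF.
have uw : u = w + (s / N) *: one by rewrite subrK.
have -> : bilin L u u = bilin L w w by rewrite uw bilin_laplacian_shift.
have -> : sqnorm u = sqnorm w + s ^+ 2 / N.
  by rewrite uw sqnorm_shift // -/N; congr (_ + _); field; rewrite gt_eqF.
have w0 := sqnorm_ge0 w.
have ge_q : N * r * sqnorm w <= b * bilin L w w.
  by have := ler_wpM2l b0 (Lge w one_w); rewrite mulrA bm1.
have le_q : b * bilin L w w <= N * sqnorm w.
  apply: le_trans (ler_wpM2l b0 (Lle w)) _; rewrite mulrA.
  exact: ler_wpM2r w0 _ _ bmn.
set q := b * bilin L w w in ge_q le_q *; set y := sqnorm w in w0 ge_q le_q *.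
pose t := s ^+ 2 / N; rewrite -/t.
have t0 : 0 <= t by rewrite divr_ge0 ?sqr_ge0 // ltW.
have -> : s ^+ 2 = N * t by rewrite /t mulrC divfK // gt_eqF.
have Nrt : 0 <= N * (1 - r) * t.
  by case/andP: r01 => r0 r1; apply: mulr_ge0 => //;
    apply: mulr_ge0; [exact: ltW|rewrite subr_ge0].
rewrite /a ler_norml; apply/andP; split; lra.
Qed.

(** Testing on the constants and on eigenvectors for mu_2 and mu_n bounds n - a,
a - b mu_2 and b mu_n - a by c. With r = mu_2 / mu_n in [0, 1], the combination of
these three with weights 1 - r, 1 and r eliminates a and b. *)
Lemma pencil_bound a b c :
  (forall u, `|bilin (pencil a b) u u| <= c * sqnorm u) ->
  n%:R * (1 - mu`_1 / mu`_n.-1) <= 2 * c.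
Proof.
move=> cP; have [/andP[mu1 mu1n] _ _ ev] := laplacian_spectrum.
have one_bound : n%:R - a <= c.
  have := le_trans (ler_norm _) (cP one).
  rewrite bilin_pencil /sqnorm one_one.
  have -> : bilin L one one = 0 by rewrite /bilin -mulmxA laplacian_one mulmx0 mxE.
  by rewrite mulr0 addr0 expr2 -mulrBl ler_pM2r // cardV_gt0.
have ev_bound i : (0 < i < n)%N -> `|b * mu`_i - a| <= c.
  move=> /ev[w [w0 w1 Lw]]; have := cP w.
  have -> : bilin (pencil a b) w w = (b * mu`_i - a) * sqnorm w.
    have -> : bilin (pencil a b) w w = b * bilin L w w - a * sqnorm w.
      by rewrite bilin_pencil w1; ring.
    have -> : bilin L w w = mu`_i * sqnorm w.
      rewrite /bilin /sqnorm -mulmxA Lw -scalemxAr.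
      by move: (w^T *m w) => B; rewrite mxE.
    by ring.
  by rewrite normrM (gtr0_norm w0) ler_pM2r.
have := ev_bound 1%N V1; rewrite ler_norml => /andP[b1 _].
have /ev_bound : (0 < n.-1 < n)%N.
  by rewrite -subn1 subn_gt0 V1 ltn_subrL /= ltnW.
rewrite ler_norml => /andP[_ bn].
set m1 := mu`_1 in mu1 mu1n b1 *; set mn := mu`_n.-1 in mu1n bn *.
have [mn0|mn0] := eqVneq mn 0.
  have m10 : m1 = 0 by apply: le_anti; rewrite mu1 -mn0 mu1n.
  by move: b1; rewrite m10 mul0r; lra.
have mn_gt0 : 0 < mn by rewrite lt_def mn0 (le_trans mu1).
have [r [r0 r1 m1E]] : exists r, [/\ 0 <= r, r <= 1 & m1 = r * mn].
  exists (m1 / mn); split; last by rewrite divfK.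
    by rewrite divr_ge0 // ltW.
  by rewrite ler_pdivrMr // mul1r.
rewrite {1}m1E mulfK //.
have l1 : 0 <= (1 - r) * (c + a - n%:R) by rewrite mulr_ge0 //; lra.
have l2 : 0 <= r * (c + a - b * mn) by rewrite mulr_ge0 //; lra.
by move: b1; rewrite m1E; lra.
Qed.

Section Averaging.
Variable M : 'M[R]_n.
Hypothesis symM : M^T = M.
Hypothesis M1 : forall x y, compl G x y -> M (enum_rank x) (enum_rank y) = 1.

Let Aut : {set {perm V}} :=
  [set s : {perm V} | [forall x, forall y, G (s x) (s y) == G x y]]%SET.

Lemma AutP (s : {perm V}) : reflect (automorphism G s) (s \in Aut).
Proof.
rewrite inE; apply: (iffP forallP) => [sG x y|sG x].
  by have /forallP/(_ y)/eqP := sG x.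
by apply/forallP => y; rewrite sG.
Qed.

Definition average x y : R :=
  #|Aut|%:R^-1 * \sum_(s in Aut) M (enum_rank (s x)) (enum_rank (s y)).

Definition average_mx : 'M[R]_n :=
  \matrix_(i, j) average (enum_val i) (enum_val j).

Lemma card_Aut : 0 < #|Aut|%:R :> R.
Proof.
rewrite ltr0n; apply/card_gt0P; exists 1%g; apply/AutP => x y.
by rewrite !perm1.
Qed.

Lemma average_sym x y : average x y = average y x.
Proof. by congr (_ * _); apply: eq_bigr => s _; rewrite -[in LHS]symM mxE. Qed.

(** Translation by an automorphism permutes the terms of the average. *)
Lemma average_aut (t : {perm V}) x y :
  automorphism G t -> average (t x) (t y) = average x y.
Proof.
move=> tG; congr (_ * _); rewrite [RHS](reindex_inj (mulgI t)) /=.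
apply: eq_big => [s|s _]; last by rewrite !permM.
apply/AutP/AutP => sG z w; first by rewrite !permM sG tG.
have := sG (t^-1%g z) (t^-1%g w); rewrite !permM !permKV => ->.
by rewrite -[in RHS](permKV t z) -[in RHS](permKV t w) tG.
Qed.

Lemma average_compl x y : compl G x y -> average x y = 1.
Proof.
move=> /andP[xy nGxy]; rewrite /average.
under eq_bigr => s /AutP sG.
  rewrite M1; last by rewrite /= /compl_adj (inj_eq perm_inj) xy sG nGxy.
  over.
by rewrite sumr_const mulVf // gt_eqF ?card_Aut.
Qed.

(** The average of the quadratic forms of M at the vectors obtained from u by
permuting the coordinates, all of the same norm. *)
Lemma average_bound u :
  `|bilin average_mx u u| <=
  lambda_abs M * sqnorm u.
Proof.
pose v (s : {perm V}) : 'cV[R]_n :=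
  \col_i u (enum_rank (s^-1%g (enum_val i))) 0.
have reidx (F : 'I_n -> R) (s : {perm V}) :
    \sum_(i < n) F i = \sum_(i < n) F (enum_rank (s (enum_val i))).
  have inj : injective (fun i : 'I_n => enum_rank (s (enum_val i)) : 'I_n).
    by move=> i j /enum_rank_inj/perm_inj/enum_val_inj.
  by rewrite (reindex_inj inj).
have vE s (i : 'I_n) : v s (enum_rank (s (enum_val i))) 0 = u i 0.
  by rewrite mxE enum_rankK permK enum_valK.
have sq_v s : sqnorm (v s) = sqnorm u.
  by rewrite !sqnormE (reidx _ s); apply: eq_bigr => i _; rewrite vE.
have bil_v s : bilin M (v s) (v s) = \sum_(i < n) \sum_(j < n) u i 0 *
    M (enum_rank (s (enum_val i))) (enum_rank (s (enum_val j))) * u j 0.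
  rewrite bilinE (reidx _ s); apply: eq_bigr => i _.
  by rewrite (reidx _ s); apply: eq_bigr => j _; rewrite !vE.
have -> : bilin average_mx u u =
    #|Aut|%:R^-1 * \sum_(s in Aut) bilin M (v s) (v s).
  under [in RHS]eq_bigr do rewrite bil_v.
  rewrite bilinE [in RHS]exchange_big /=.
  rewrite mulr_sumr; apply: eq_bigr => i _; rewrite exchange_big mulr_sumr.
  apply: eq_bigr => j _; rewrite mxE /average mulrCA -mulrA; congr (_ * _).
  by rewrite mulr_sumr mulr_suml.
rewrite normrM [`|_^-1|]ger0_norm ?invr_ge0 ?ler0n // ler_pdivrMl ?card_Aut //.
apply: le_trans (ler_norm_sum _ _ _) _.
rewrite mulr_natl -sumr_const; apply: ler_sum => s _; rewrite -(sq_v s).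
exact: lambda_abs_bound.
Qed.

(** Vertex transitivity makes the diagonal and the degrees constant, say of degree k,
so that the adjacency matrix is k I - L; edge transitivity makes the entries on
the edges constant, symmetry covering the automorphisms that reverse an edge. *)
Lemma average_pencil : vertex_transitive G -> edge_transitive G ->
  exists a b, average_mx = pencil a b.
Proof.
move=> vtG etG; pose x0 : V := enum_val (Ordinal (ltnW V1)).
pose k := \sum_j g (Ordinal (ltnW V1)) j.
have regular i : \sum_j g i j = k.
  rewrite /k -!degmx_sum -/x0; have [s sG <-] := vtG (enum_val i) x0.
  congr (_%:R).
  rewrite -(card_imset (mem [set y | G (enum_val i) y]%SET) (@perm_inj _ s)).
  apply: eq_card => y; rewrite inE; apply/imsetP/idP => [[z] |Gsy].
    by rewrite inE => Gz ->; rewrite sG.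
  by exists (s^-1%g y); rewrite ?permKV // inE -sG permKV.
have diag x : average x x = average x0 x0.
  by have [s sG <-] := vtG x x0; rewrite average_aut.
have [beta betaP] : exists beta, forall x y, G x y -> average x y = beta.
  have [[x [y Gxy]]|noE] := pselect (exists x y, G x y); last first.
    by exists 0 => x y Gxy; case: noE; exists x, y.
  exists (average x y) => z t Gzt.
  have [s sG /setP sE] := etG _ _ _ _ Gxy Gzt.
  have zt : z != t by apply: contraTneq Gzt => ->; rewrite adj_irr.
  rewrite -(average_aut x y sG).
  have := sE z; have := sE t; rewrite !inE !eqxx orbT /=.
  case/orP => /eqP ez /orP[] /eqP et.
  - by rewrite ez et eqxx in zt.
  - by rewrite ez et average_sym.
  - by rewrite ez et.
  - by rewrite ez et eqxx in zt.
exists (1 - average x0 x0 - (beta - 1) * k), (1 - beta).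
apply/matrixP => i j; rewrite mxE pencilE laplacianE regular.
have [->|ij] := eqVneq i j.
  by rewrite !mulr1n diag /g adj_irr mulr0n; ring.
rewrite !mulr0n /g; case: (boolP (G _ _)) => Gij.
  by rewrite betaP // mulr1n; ring.
rewrite average_compl; first by rewrite mulr0n; ring.
by rewrite /= /compl_adj Gij andbT (inj_eq enum_val_inj).
Qed.

End Averaging.

Theorem phiH_le_phi_compl : vertex_transitive G -> edge_transitive G ->
  phiH R G <= phi R (compl G).
Proof.
move=> vtG etG; have [[M [/symmetricmxP symM M1] <-] _] := phi_compl_spec R G (ltnW V1).
have [a [b Mab]] := average_pencil symM M1 vtG etG.
have := @pencil_bound a b (lambda_abs M); rewrite -Mab.
move=> /(_ (average_bound symM)); rewrite phiHE; lra.
Qed.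
End Laplacian.

Theorem proposition4p8 (R : realType) (V : finType) (G : graph V) :
  (0 < #|V|)%N ->
  let n : R := #|V|%:R in
  let mu := eigenvalues (laplacian R G) in
  [/\ h1_values R (B0 G) (h1 R (B0 G)),
      phi_values R (compl G) (phi R (compl G)),
      h1 R (B0 G) = phi R (compl G) / 2 &
      (1 < #|V|)%N ->
      [/\ phi R (compl G) / 2 <= phiH R G / 2,
          phiH R G / 2 = n / 4 * (1 - mu`_1 / mu`_#|V|.-1) &
          vertex_transitive G -> edge_transitive G ->
          phi R (compl G) / 2 = phiH R G / 2]].
Proof.
move=> V0 n mu; have [phi_val h1_phi] := phi_compl_spec R G V0.
split=> // [|V1].
  by apply: h1_attained; rewrite card_sum addn_gt0 V0.
have le_phi := phi_compl_le_phiH R G V1.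
split=> [||vtG etG].
- by rewrite ler_pM2r ?invr_gt0 ?ltr0n.
- by rewrite phiHE -/mu -/n; move: (mu`_1 / _) => r; field.
- congr (_ * _); apply: le_anti; by rewrite le_phi phiH_le_phi_compl.
Qed.
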